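(* Let $G$ be an oligomorphic closed subgroup of $\mathrm{Sym}(\omega)$ that is $\mathfrak G$-finite. Then $G$ has an essential subgroup.
   Context: $\mathrm{Sym}(\omega)$ is the Polish group of permutations of $\omega$ (neighbourhood basis of $1$: pointwise stabilisers of finite sets). A subgroup $G\leq\mathrm{Sym}(\omega)$ is oligomorphic if for each $n$ the canonical action of $G$ on $\omega^n$ has only finitely many orbits. An oligomorphic group $G$ is $\mathfrak G$-finite if each open subgroup $U$ of $G$ contains a least open subgroup of finite index (in $U$). Above any open subgroup $U$ of $G$ there are only finitely many subgroups of $G$. The depth of an open subgroup $U$ is the minimum of the lengths of maximal chains of subgroups leading from $U$ to $G$ (so $G$ has depth $0$). An open subgroup of $G$ is irreducible if it has no proper open subgroup of finite index. An irreducible open subgroup $H$ of $G$ is almost essential if every open subgroup of $G$ contains a finite intersection of conjugates of $H$. It is essential if it is almost essential and its depth is minimal among the almost essential subgroups of $G$. *)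

(* Defs.v *)
From HB Require Import structures.
From mathcomp Require Import all_boot.
From mathcomp Require Import boolp classical_sets functions cardinality filter.
From mathcomp Require Import topology.

Set Implicit Arguments.
Unset Strict Implicit.
Unset Printing Implicit Defensive.

Import Algebra.

Local Open Scope classical_set_scope.
Local Open Scope card_scope.
Local Open Scope group_scope.

Record sym := Sym { sym_fun :> nat -> nat; sym_bij : bijective sym_fun }.

Lemma symP (g h : sym) : g =1 h -> g = h.
Proof.
case: g h => [g gb] [h hb] /= /funext gh.
by case: _ / gh hb => hb; rewrite (Prop_irrelevance gb hb).
Qed.

HB.instance Definition _ := gen_eqMixin sym.
HB.instance Definition _ := gen_choiceMixin sym.

Lemma sym_inv_subproof (g : sym) :
  {f : nat -> nat | cancel g f /\ cancel f g}.
Proof. by apply: cid; case: (sym_bij g) => f gK fK; exists f. Qed.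

Lemma sym_inv_bij (g : sym) : bijective (sval (sym_inv_subproof g)).
Proof. by case: sym_inv_subproof => f [gK fK]; exists g. Qed.

Definition sym_one : sym := Sym (@inv_bij nat id (fun=> erefl)).
Definition sym_mul (g h : sym) : sym := Sym (bij_comp (sym_bij g) (sym_bij h)).
Definition sym_inv (g : sym) : sym := Sym (sym_inv_bij g).

Lemma sym_mulA : associative sym_mul.
Proof. by move=> g h k; apply: symP. Qed.

Lemma sym_mul1g : left_id sym_one sym_mul.
Proof. by move=> g; apply: symP. Qed.

Lemma sym_mulg1 : right_id sym_one sym_mul.
Proof. by move=> g; apply: symP. Qed.

Lemma sym_mulVg : left_inverse sym_one sym_inv sym_mul.
Proof.
by move=> g; apply: symP => x /=; case: sym_inv_subproof => f [gK fK] /=.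
Qed.

Lemma sym_mulgV : right_inverse sym_one sym_inv sym_mul.
Proof.
by move=> g; apply: symP => x /=; case: sym_inv_subproof => f [gK fK] /=.
Qed.

HB.instance Definition _ := isGroup.Build sym
  sym_mulA sym_mul1g sym_mulg1 sym_mulVg sym_mulgV.

Definition pstab (F : set nat) : set sym :=
  [set s | forall x, F x -> s x = x].

(* The neighbourhoods of g are the translates by g of those of 1. *)
Definition sym_nbhs (g : sym) : set_system sym :=
  filter_from [set F : set nat | finite_set F]
    (fun F => [set g * s | s in pstab F]).

HB.instance Definition _ := hasNbhs.Build sym sym_nbhs.

Lemma sym_nbhs_filter (g : sym) : ProperFilter (nbhs g).
Proof.
apply: filter_from_proper; last first.
  by move=> F _; exists (g * 1); exists 1.
apply: filter_from_filter; first by exists set0; exact: finite_set0.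
move=> F1 F2 f1 f2; exists (F1 `|` F2); first by rewrite /= finite_setU.
move=> _ [s sF <-]; split; exists s => // x xF; apply: sF; [by left|by right].
Qed.

Lemma sym_nbhs_singleton (g : sym) (A : set sym) : nbhs g A -> A g.
Proof. by move=> [F _]; apply; exists 1 => //; rewrite mulg1. Qed.

Lemma sym_nbhs_nbhs (g : sym) (A : set sym) : nbhs g A -> nbhs g (nbhs^~ A).
Proof.
move=> [F finF FA]; exists F => // _ [s sF <-]; exists F => // _ [t tF <-].
apply: FA; exists (s * t); last by rewrite mulgA.
by move=> x Fx; rewrite [LHS]/= tF// sF.
Qed.

HB.instance Definition _ := Nbhs_isNbhsTopological.Build sym
  sym_nbhs_filter sym_nbhs_singleton sym_nbhs_nbhs.

Definition subgroup (H : set sym) : Prop := group_closed [in H].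

Definition sym_orbit (G : set sym) (n : nat) (t : 'I_n -> nat) :
  set ('I_n -> nat) := [set g \o t | g in G].

Definition oligomorphic (G : set sym) : Prop :=
  forall n : nat, finite_set [set sym_orbit G t | t in [set: 'I_n -> nat]].

Definition open_subgroup (G U : set sym) : Prop :=
  [/\ subgroup U, U `<=` G & open (U : set (subspace G))].

Definition finite_index (U V : set sym) : Prop :=
  V `<=` U /\ finite_set [set [set u * v | v in V] | u in U].

Definition fin_index_open (U V : set sym) : Prop :=
  open_subgroup U V /\ finite_index U V.

Definition Gfinite (G : set sym) : Prop :=
  forall U, open_subgroup G U ->
    exists2 V, fin_index_open U V & forall W, fin_index_open U W -> V `<=` W.

Definition irreducible (G U : set sym) : Prop :=
  open_subgroup G U /\ forall V, fin_index_open U V -> V = U.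

Definition subgroup_chain (U G : set sym) (C : set (set sym)) : Prop :=
  (forall K, C K -> [/\ subgroup K, U `<=` K & K `<=` G]) /\
  total_on C (fun K L => K `<=` L).

(* By maximality such a chain contains both U and G. *)
Definition maximal_chain (U G : set sym) (C : set (set sym)) : Prop :=
  subgroup_chain U G C /\
  forall D, subgroup_chain U G D -> C `<=` D -> D = C.

(* The length of a chain of n.+1 subgroups is n. *)
Definition has_maximal_chain (U G : set sym) (n : nat) : Prop :=
  exists2 C, maximal_chain U G C & C #= `I_n.+1.

Definition has_depth (G U : set sym) (d : nat) : Prop :=
  has_maximal_chain U G d /\ forall n, has_maximal_chain U G n -> (d <= n)%N.

Definition almost_essential (G H : set sym) : Prop :=
  irreducible G H /\
  forall U, open_subgroup G U ->
    exists F : set sym, [/\ finite_set F, F `<=` G &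
      \bigcap_(g in F) [set h ^ g | h in H] `<=` U].

Definition essential (G H : set sym) : Prop :=
  almost_essential G H /\
  exists2 d, has_depth G H d &
    forall K n, almost_essential G K -> has_depth G K n -> (d <= n)%N.

(* Main.v *)
Require Import Defs.
From mathcomp Require Import all_boot finmap.
From mathcomp Require Import boolp classical_sets cardinality.
From mathcomp Require Import topology.

Set Implicit Arguments.
Unset Strict Implicit.
Unset Printing Implicit Defensive.

Import Algebra.

Local Open Scope classical_set_scope.
Local Open Scope card_scope.
Local Open Scope group_scope.

(** Since [G] has finitely many orbits on points, it has an open subgroup fixing a representative of
    each orbit, and by [Gfinite] this contains an irreducible open [H]. Every point can be moved by
    [G] to a representative, so some conjugate of [H] fixes it; hence finitely many conjugates of
    [H] intersect inside any given open subgroup, and [H] is almost essential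
    ([ex_almost_essential]). Oligomorphy also leaves only finitely many subgroups above an open one
    ([finite_overgroups]), so maximal chains are finite and depths exist ([ex_depth]). An almost
    essential subgroup of least depth is essential. *)

Lemma subgroup1 (H : set sym) : subgroup H -> H 1.
Proof. by case=> /set_mem. Qed.

Lemma subgroupV (H : set sym) (g : sym) : subgroup H -> H g -> H g^-1.
Proof.
move=> [H1 HD] Hg; apply: set_mem.
by rewrite -[g^-1]mul1g; apply: HD => //; exact: mem_set.
Qed.

Lemma subgroupM (H : set sym) (g h : sym) :
  subgroup H -> H g -> H h -> H (g * h).
Proof.
move=> sH Hg Hh; have HV := subgroupV sH Hh; case: sH => _ HD.
by apply: set_mem; rewrite -[h]invgK; apply: HD; exact: mem_set.
Qed.

Lemma subgroupI (H : set sym) :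
  H 1 -> (forall g, H g -> H g^-1) -> (forall g h, H g -> H h -> H (g * h)) ->
  subgroup H.
Proof.
move=> H1 HV HM; split; first exact: mem_set.
move=> g h /set_mem Hg /set_mem Hh.
by apply: mem_set; apply: HM => //; exact: HV.
Qed.

Lemma sym_mulE (g h : sym) (x : nat) : (g * h) x = g (h x).
Proof. by []. Qed.

Lemma symVK (g : sym) (x : nat) : g^-1 (g x) = x.
Proof. by rewrite -sym_mulE mulVg. Qed.

Lemma pstab_subgroup (F : set nat) : subgroup (pstab F).
Proof.
apply: subgroupI => [//|g gF x Fx|g h gF hF x Fx].
  by rewrite -{1}(gF x Fx) symVK.
by rewrite sym_mulE hF// gF.
Qed.

Lemma subgroup_setI (H K : set sym) :
  subgroup H -> subgroup K -> subgroup (H `&` K).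
Proof.
move=> sH sK; apply: subgroupI => [|g [Hg Kg]|g h [Hg Kg] [Hh Kh]].
- by split; exact: subgroup1.
- by split; exact: subgroupV.
- by split; exact: subgroupM.
Qed.

Lemma open_subgroupP (G U : set sym) : subgroup G -> subgroup U -> U `<=` G ->
  open (U : set (subspace G)) <->
  exists2 F, finite_set F & G `&` pstab F `<=` U.
Proof.
move=> sG sU UG; split.
  move=> /open_subspaceP[V oV VU].
  have [V1 _] : (V `&` G) 1 by rewrite VU; split; exact: subgroup1.
  move: oV; rewrite openE => /(_ _ V1)[F finF FV]; exists F => // g [Gg gF].
  suff : (V `&` G) g by rewrite VU => -[].
  by split => //; apply: FV; exists g => //; rewrite mul1g.
move=> [F finF FU]; apply/open_subspaceP.
(* This union of basic neighbourhoods meets [G] only in [U]: if [u * s] lies in [G], then so does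
   [s], which is therefore in [U]. *)
exists [set u * s | u in U & s in pstab F].
  rewrite openE => _ [u Uu [s sF <-]]; exists F => // _ [t tF <-].
  exists u => //; exists (s * t); last by rewrite mulgA.
  exact: subgroupM (pstab_subgroup F) sF tF.
apply/seteqP; split => [_ [[u Uu [s sF <-]] Gus]|u [Uu Gu]]; split => //.
  apply: subgroupM => //; apply: FU; split => //.
  rewrite -[s](mulKg u); apply: subgroupM => //.
  by apply: subgroupV => //; exact: UG.
by exists u => //; exists 1; rewrite ?mulg1.
Qed.

Lemma open_subgroup_trans (G U V : set sym) : subgroup G ->
  open_subgroup G U -> open_subgroup U V -> open_subgroup G V.
Proof.
move=> sG [sU UG] /(open_subgroupP sG sU UG)[F finF FU].
move=> [sV VU] /(open_subgroupP sU sV VU)[E finE EV].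
split=> //; first exact: subset_trans UG.
apply/(open_subgroupP sG sV (subset_trans VU UG)).
exists (F `|` E); first by rewrite finite_setU.
by move=> g [Gg gFE]; apply: EV; split;
  [apply: FU; split=> // x Fx|move=> x Ex]; apply: gFE; [left|right].
Qed.

(** Once a representative [r] is chosen for each coset of [V] in [U], every coset of [W] in [U] is
    the translate by some [r] of a coset of [W] in [V]. *)
Lemma finite_index_trans (U V W : set sym) : subgroup V ->
  finite_index U V -> finite_index V W -> finite_index U W.
Proof.
move=> sV [VU finUV] [WV finVW]; split; first exact: subset_trans VU.
pose r (C : set sym) := xget 1 [set u | U u /\ [set u * v | v in V] = C].
apply: sub_finite_set (finite_image2
  (fun C D => [set r C * v | v in D]) finUV finVW).
move=> _ [u Uu <-]; set uV := [set u * v | v in V].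
have [Ur rE] : U (r uV) /\ [set r uV * v | v in V] = uV.
  by rewrite /r; case: xgetP => [_ -> //|/(_ u)[]].
have : uV u by exists 1; rewrite ?mulg1//; exact: subgroup1.
rewrite -rE => -[v Vv uE]; exists uV; first by exists u.
exists [set v * w | w in W]; first by exists v.
by rewrite image_comp -[in RHS]uE; apply: eq_imagel => w _ /=; rewrite mulgA.
Qed.

Lemma finite_powerset T (A : set T) :
  finite_set A -> finite_set [set B | B `<=` A].
Proof.
elim/Pchoice: T => T in A *.
move=> finA.
apply: sub_finite_set
  (finite_image (fun X => [set` X]) (finite_fset (fpowerset (fset_set A)))).
move=> B BA; have finB := sub_finite_set BA finA; exists (fset_set B).
  by rewrite /= fpowersetE -fset_set_sub.
exact: fset_setK.
Qed.

(* A subgroup between U and G is a union of double cosets of the stabiliser in G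
   of a tuple t, and the double coset of g is recorded by the orbit of the
   concatenation of t with g \o t. *)
Lemma finite_overgroups (G U : set sym) : subgroup G -> oligomorphic G ->
  open_subgroup G U ->
  finite_set [set K | [/\ subgroup K, U `<=` K & K `<=` G]].
Proof.
move=> sG oligG [sU UG] /(open_subgroupP sG sU UG)[F /finite_seqP[s ->] FU].
pose p (g : sym) (i : 'I_(size s + size s)) :=
  match split i with inl j => nth 0 s j | inr j => g (nth 0 s j) end.
pose Phi (K : set sym) := [set sym_orbit G (p g) | g in K].
have Phi_le K L : K `<=` G -> subgroup L -> U `<=` L -> L `<=` G ->
    Phi K `<=` Phi L -> K `<=` L.
  move=> KG sL UL LG KL g Kg; have [|l Ll lg] := KL (sym_orbit G (p g)).
    by exists g.
  have : sym_orbit G (p g) (p g) by exists 1; first exact: subgroup1.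
  (* This [h] fixes [s] pointwise and carries the image of [s] under [l] to its image under [g]. So
     both [h] and [g^-1 * (h * l)] fix [s] and lie in [U], which puts [g] in [L]. *)
  rewrite -lg => -[h Gh /funeqP hpE].
  have ht j : h (nth 0 s (j : 'I_(size s))) = nth 0 s j.
    by have := hpE (unsplit (inl j)); rewrite /comp /p unsplitK.
  have hlt j : h (l (nth 0 s (j : 'I_(size s)))) = g (nth 0 s j).
    by have := hpE (unsplit (inr j)); rewrite /comp /p unsplitK.
  have Gl := LG _ Ll; have Gg := KG _ Kg.
  have Lh : L h.
    apply/UL/FU; split => // x xs.
    have xI : index x s < size s by rewrite index_mem.
    by have := ht (Ordinal xI); rewrite /= nth_index.
  have Lx : L (g^-1 * (h * l)).
    apply/UL/FU; split.
      by apply: subgroupM (subgroupV sG Gg) (subgroupM sG Gh Gl).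
    move=> x xs; have xI : index x s < size s by rewrite index_mem.
    have hlx : h (l x) = g x by have := hlt (Ordinal xI); rewrite /= nth_index.
    by rewrite !sym_mulE hlx symVK.
  have -> : g = h * l * (g^-1 * (h * l))^-1 by rewrite invgM invgK mulVKg.
  by apply: subgroupM (subgroupM sL Lh Ll) (subgroupV sL Lx).
have Phi_inj : {in [set K | [/\ subgroup K, U `<=` K & K `<=` G]] &,
    injective Phi}.
  move=> K L /set_mem[sK UK KG] /set_mem[sL UL LG] PKL.
  by apply/seteqP; split; apply: Phi_le => //; rewrite PKL.
rewrite -(eq_finite_set (inj_card_eq Phi_inj)).
apply: sub_finite_set (finite_powerset (oligG (size s + size s))).
by move=> _ [K _ <-] _ [g _ <-]; exists (p g).
Qed.

Lemma ex_has_maximal_chain (G U : set sym) : subgroup G -> oligomorphic G ->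
  open_subgroup G U -> exists n, has_maximal_chain U G n.
Proof.
move=> sG oligG oU; have [sU UG _] := oU.
have [F FP totF|C [[CP totC] maxC]] := @Zorn_bigcup _ (subgroup_chain U G).
  split=> [K [C /FP[CP _]]|K L [C FC CK] [D FD DL]]; first exact: CP.
  have [CD|DC] := totF _ _ FC FD.
    by have [_] := FP _ FD; apply => //; exact: CD.
  by have [_] := FP _ FC; apply => //; exact: DC.
have maxCE D : subgroup_chain U G D -> C `<=` D -> D = C.
  move=> chD CD; apply/seteqP; split => // ; apply: contrapT => DC.
  exact: maxC chD.
have /finite_setP[[|n] Cn] : finite_set C.
- exact: sub_finite_set CP (finite_overgroups sG oligG oU).
(* A maximal chain is nonempty, since the chain with sole member [U] extends the empty one; so its
   cardinality is a successor, as [has_maximal_chain] requires. *)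
- have /maxCE : subgroup_chain U G [set U].
    by split=> [K ->|K L -> ->]; [split|left].
  move: Cn; rewrite II0 card_eq0 => /eqP ->.
  by move=> /(_ (@sub0set _ _))/seteqP[/(_ U)[]].
- by exists n, C.
Qed.

Lemma ex_least (P : nat -> Prop) :
  (exists n, P n) -> exists2 n, P n & forall m, P m -> n <= m.
Proof.
move=> [n Pn]; have exP : exists n, `[< P n >] by exists n; apply/asboolP.
case: (ex_minnP exP) => m /asboolP Pm minm; exists m => // k /asboolP.
exact: minm.
Qed.

Lemma ex_depth (G U : set sym) : subgroup G -> oligomorphic G ->
  open_subgroup G U -> exists d, has_depth G U d.
Proof.
move=> sG oligG oU.
by have [d] := ex_least (ex_has_maximal_chain sG oligG oU); exists d.
Qed.

Lemma fin_index_open_trans (U V W : set sym) : subgroup U ->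
  fin_index_open U V -> fin_index_open V W -> fin_index_open U W.
Proof.
move=> sU [oV iV] [oW iW]; split.
  exact: open_subgroup_trans oV oW.
by apply: finite_index_trans iV iW; case: oV.
Qed.

(** The least open subgroup of finite index in [U] is irreducible, because an open subgroup of
    finite index in it also has finite index in [U]. *)
Lemma Gfinite_irreducible (G U : set sym) : subgroup G -> Gfinite G ->
  open_subgroup G U -> exists2 H, irreducible G H & H `<=` U.
Proof.
move=> sG finG oU; have [sU _ _] := oU.
have [H iH minH] := finG U oU; have [oH [HU _]] := iH.
exists H => //; split; first exact: open_subgroup_trans oU oH.
move=> V iV; apply/seteqP; split; first by case: iV => -[].
by apply: minH; exact: fin_index_open_trans iH iV.
Qed.

(* The stabiliser of a finite set of representatives of the orbits on points has
   the property that finite intersections of its conjugates form a basis at 1;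
   this property is inherited by smaller subgroups. *)
Lemma ex_almost_essential (G : set sym) : subgroup G -> oligomorphic G ->
  Gfinite G -> exists H, almost_essential G H.
Proof.
move=> sG oligG finG.
(* Points are handled as 1-tuples; orbits are nonempty, so the default tuple is never selected for
   them. *)
pose r (O : set ('I_1 -> nat)) := xget (fun=> 0) O ord0.
pose A := [set r (sym_orbit G t) | t in [set: 'I_1 -> nat]].
have finA : finite_set A by rewrite /A -image_comp; exact: finite_image.
have orbA x : exists g, G g /\ A (g x).
  pose t := fun _ : 'I_1 => x.
  have : A (r (sym_orbit G t)) by exists t.
  rewrite /r; case: xgetP => [_ -> [g Gg <-]|/(_ t)[]]; first by exists g.
  by exists 1; first exact: subgroup1.
have /choice[c cP] := orbA.
have oGA : open_subgroup G (G `&` pstab A).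
  have sGA := subgroup_setI sG (pstab_subgroup A).
  by split=> //; apply/open_subgroupP => //; exists A.
have [H irrH HA] := Gfinite_irreducible sG finG oGA.
exists H; split=> // U [sU UG /(open_subgroupP sG sU UG)[F finF FU]].
(* The conjugator [1] keeps the intersection inside [G], even when [F] is empty. As [c x] sends [x]
   into [A], which [H] fixes pointwise, the conjugate of [H] by [c x] fixes [x]. *)
exists (1 |` [set c x | x in F]); split.
- by rewrite finite_setU; split; [exact: finite_set1|exact: finite_image].
- by move=> _ [->|[x _ <-]]; [exact: subgroup1|exact: (cP x).1].
move=> g gP; apply: FU; split.
  have [|h Hh <-] := gP 1; first by left.
  by rewrite conjg1; exact: (HA _ Hh).1.
move=> x Fx; have [|h Hh <-] := gP (c x); first by right; exists x.
rewrite conjgE !sym_mulE (HA _ Hh).2 ?symVK//; exact: (cP x).2.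
Qed.

Theorem proposition5p14 (G : set sym) (hG : subgroup G) (hclosed : closed G)
  (holig : oligomorphic G) (hfin : Gfinite G) :
  exists H : set sym, essential G H.
Proof.
have [|d [H aeH dH] minH] :=
    @ex_least (fun d => exists2 H, almost_essential G H & has_depth G H d).
  have [H aeH] := ex_almost_essential hG holig hfin.
  by have [d dH] := ex_depth hG holig aeH.1.1; exists d, H.
by exists H; split=> //; exists d => // K n aeK dK; apply: minH; exists K.
Qed.
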